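(* Let $\Sigma=\{0,1\}$, let $P\subseteq\Sigma^*\setminus\{\epsilon\}$ be finite and prefix-free, and let $\mathcal A_P=(V,\delta,r_0)$ be its trie automaton. The product automaton $\mathcal M_P$ has at most $90|V|^2$ states. Therefore a breadth-first search over the reachable states of $\mathcal M_P$ terminates using $O(|V|^2)$ memory, independently of any codeword length. The search returns SUCCESS (no accepting state is reachable) if and only if $C_n(P)$ is correcting for every $n\ge0$; otherwise it returns a shortest collision.
   Context: Prefix-free means no word of $P$ is a proper prefix of another word of $P$. $P^*$ is the set of all finite concatenations (including the empty word $\epsilon$) of words of $P$, and $C_n(P)=P^*\cap\Sigma^n$. For $c\in\Sigma^n$, $B(c)$ is the set of words $z_1\cdots z_n$ with $z_i=c_{\pi(i)}$ for a permutation $\pi$ of $\{1,\dots,n\}$ with $|\pi(i)-i|\le1$ for all $i$ (equivalently, words obtained by swapping any set of pairwise disjoint adjacent pairs of positions). A code $C\subseteq\Sigma^n$ is correcting if $B(c)\cap B(c')=\emptyset$ for all distinct $c,c'\in C$. A collision is a received word $z\in\Sigma^n$ together with distinct $c_1,c_2\in C_n(P)$ such that $z\in B(c_1)\cap B(c_2)$; it is shortest if its received length $n=|z|$ is minimum among all collisions. Trie automaton $\mathcal A_P=(V,\delta,r_0)$: $V$ is the set of all proper prefixes of words of $P$, including $\epsilon$; $r_0=\epsilon$; $\delta:V\times\Sigma\to V$ is partial: $\delta(v,b)=vb$ if $vb$ is a proper prefix of a word of $P$; $\delta(v,b)=r_0$ if $vb\in P$; undefined otherwise. Parser: micro-states are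 pairs $(v,p)$ with $v\in V$, $p\in\{\circ,H_0,H_1\}$. On reading $\beta\in\Sigma$, the legal moves are: copy, from $(v,\circ)$ to $(\delta(v,\beta),\circ)$, emitting $\beta$, provided $\delta(v,\beta)$ is defined; swap-start, from $(v,\circ)$ to $(v,H_\beta)$, emitting $\epsilon$; swap-resolve, from $(v,H_h)$ to $(\delta(\delta(v,\beta),h),\circ)$, emitting $\beta h$, provided both transitions are defined. Product automaton $\mathcal M_P$: states are tuples $(v_1,p_1,v_2,p_2,\mathrm{div},\mathrm{lead})$ with $v_1,v_2\in V$, $p_1,p_2\in\{\circ,H_0,H_1\}$, $\mathrm{div}\in\{\bot,\top\}$, $\mathrm{lead}\in\{\circ,L_1(0),L_1(1),L_2(0),L_2(1)\}$. The initial state is $(r_0,\circ,r_0,\circ,\bot,\circ)$. Transitions on $\beta\in\Sigma$: for $i=1,2$ choose a legal parser move on $\beta$ from $(v_i,p_i)$ to $(v_i',p_i')$ emitting $\eta_i$. Put $\xi_1=\eta_1,\ \xi_2=\eta_2$ if $\mathrm{lead}=\circ$; $\xi_1=a\eta_1,\ \xi_2=\eta_2$ if $\mathrm{lead}=L_1(a)$; $\xi_1=\eta_1,\ \xi_2=a\eta_2$ if $\mathrm{lead}=L_2(a)$. Compare $\xi_1$ and $\xi_2$ symbol by symbol from the left for as long as both have a symbol available; set $\mathrm{div}'=\top$ if some compared pair is unequal, otherwise $\mathrm{div}'=\mathrm{div}$. Delete the compared symbols from both words; on reachable states at most one symbol remains in total. Set $\mathrm{lead}'=\circ$ if none remains,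 $\mathrm{lead}'=L_i(a)$ if one symbol $a$ remains on side $i$. The new state is $(v_1',p_1',v_2',p_2',\mathrm{div}',\mathrm{lead}')$. A state is accepting if $v_1=v_2=r_0$, $p_1=p_2=\circ$, $\mathrm{lead}=\circ$ and $\mathrm{div}=\top$. The breadth-first search starts at the initial state and explores states in order of the number of received symbols read; it returns SUCCESS if no accepting state is found, and otherwise returns the collision (received word and the two reconstructed, i.e. emitted, words) given by the path to the first accepting state found. Memory is measured by the number of stored product states. *)

(* Defs.v *)
From HB Require Import structures.
From mathcomp Require Import all_boot ssralg ssrint perm.
From mathcomp Require Import finmap.

Set Implicit Arguments.
Unset Strict Implicit.
Unset Printing Implicit Defensive.

Local Open Scope fset_scope.

(* The alphabet {0,1} is bool, with 0 = false and 1 = true. *)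
Notation word := (seq bool).

Definition proper_prefix (u w : word) : bool := prefix u w && (u != w).

Definition prefix_free (P : {fset word}) : Prop :=
  forall u w, u \in P -> w \in P -> ~~ proper_prefix u w.

Definition star (P : {fset word}) (c : word) : Prop :=
  exists s : seq word, {subset s <= P} /\ c = flatten s.

(* C_n(P); the length n is carried by the type of c. *)
Definition code (P : {fset word}) (n : nat) (c : n.-tuple bool) : Prop :=
  star P c.

(* [ball c z] reads z \in B(c). *)
Definition ball (n : nat) (c z : n.-tuple bool) : Prop :=
  exists pi : 'S_n,
    (forall i, absz (Posz (pi i) - Posz i)%R <= 1) /\
    (forall i, tnth z i = tnth c (pi i)).

Definition correcting (n : nat) (C : n.-tuple bool -> Prop) : Prop :=
  forall c c', C c -> C c' -> c <> c' -> ~ exists z, ball c z /\ ball c' z.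

Definition collision (P : {fset word}) (n : nat) (z c1 c2 : n.-tuple bool) :
    Prop :=
  [/\ code P c1, code P c2, c1 <> c2, ball c1 z & ball c2 z].

Definition shortest_collision (P : {fset word}) (n : nat)
    (z c1 c2 : n.-tuple bool) : Prop :=
  collision P z c1 c2 /\
  forall m (z' c1' c2' : m.-tuple bool), collision P z' c1' c2' -> n <= m.

(* The vertex set V; it contains the empty word even when P is empty. *)
Definition trie (P : {fset word}) : {fset word} :=
  [::] |` [fset u | w in P, u in [seq take k w | k <- iota 0 (size w)]].

Lemma trieP (P : {fset word}) (u : word) :
  reflect (u = [::] \/ exists2 w, w \in P & proper_prefix u w) (u \in trie P).
Proof.
rewrite /trie in_fset1U; apply: (iffP orP) => -[].
- by move/eqP; left.
- case/imfset2P => w /= wP [v /= /mapP[k]]; rewrite mem_iota /= add0n => kw -> ->.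
  right; exists w => //; rewrite /proper_prefix prefix_take /=.
  by apply/eqP => /(congr1 size); rewrite size_take kw => e; rewrite e ltnn in kw.
- by move->; left.
case=> w wP /andP[/prefixP[v def_w] ne]; right; apply/imfset2P.
exists w => //; exists u => //=; apply/mapP; exists (size u); last first.
  by rewrite def_w take_size_cat.
rewrite mem_iota /= add0n def_w size_cat -addn1 leq_add2l lt0n size_eq0.
by apply: contra ne => /eqP v0; rewrite def_w v0 cats0.
Qed.

Fact root_proof (P : {fset word}) : [::] \in trie P.
Proof. exact: fset1U1. Qed.

Section Automata.

Variable P : {fset word}.

Definition root : trie P := [` root_proof P].

(* [insub] succeeds exactly when the extended word is again a trie vertex. *)
Definition delta (v : trie P) (b : bool) : option (trie P) :=
  if insub (rcons (val v) b) is Some v' then Some v'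
  else if rcons (val v) b \in P then Some root
  else None.

(* Parser modes: None is the idle mode, Some h is H_h. *)
Definition micro : finType := (trie P * option bool)%type.

(* The legal moves on b, each with the word it emits. *)
Definition moves (q : micro) (b : bool) : seq (micro * word) :=
  match q with
  | (v, None) =>
      (if delta v b is Some v' then [:: ((v', None), [:: b])] else [::])
      ++ [:: ((v, Some b), [::])]
  | (v, Some h) =>
      if obind (delta^~ h) (delta v b) is Some v'
      then [:: ((v', None), [:: b; h])] else [::]
  end.

(* None: no pending symbol; inl a: L_1(a); inr a: L_2(a). *)
Definition lead : finType := option (bool + bool).

(* ((v_1, p_1), (v_2, p_2), div, lead) *)
Definition state : finType := (micro * micro * bool * lead)%type.

Definition init : state := ((root, None), (root, None), false, None).

Definition accepting (q : state) : bool :=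
  q == ((root, None), (root, None), true, None).

Definition pending (l : lead) : word * word :=
  match l with
  | None => ([::], [::])
  | Some (inl a) => ([:: a], [::])
  | Some (inr a) => ([::], [:: a])
  end.

(* The updated divergence flag and what remains of both words. *)
Fixpoint compare (dv : bool) (x y : word) : bool * (word * word) :=
  match x, y with
  | a :: x', b :: y' => compare (dv || (a != b)) x' y'
  | _, _ => (dv, (x, y))
  end.

(* None if two or more symbols remain; by [settle_reachable] below this never
   happens from a reachable state. *)
Definition lead_of (r : word * word) : option lead :=
  match r with
  | ([::], [::]) => Some None
  | ([:: a], [::]) => Some (Some (inl a))
  | ([::], [:: a]) => Some (Some (inr a))
  | _ => None
  end.

Definition settle (dv : bool) (l : lead) (e1 e2 : word) : option (bool * lead) :=
  let: (dv', r) := compare dv ((pending l).1 ++ e1) ((pending l).2 ++ e2) in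
  omap (pair dv') (lead_of r).

(* The transitions on b, each with the two emitted words. *)
Definition succ (q : state) (b : bool) : seq (state * (word * word)) :=
  let: (q1, q2, dv, l) := q in
  pmap (fun m : (micro * word) * (micro * word) =>
          let: ((q1', e1), (q2', e2)) := m in
          omap (fun s => ((q1', q2', s.1, s.2), (e1, e2))) (settle dv l e1 e2))
       [seq (m1, m2) | m1 <- moves q1 b, m2 <- moves q2 b].

Definition transition : rel state :=
  fun q q' => [exists b, q' \in unzip1 (succ q b)].

Definition reachable (q : state) : bool := connect transition init q.

(* The pending symbol is determined by which of the two parsers is holding. *)
Let synced (q : state) : bool :=
  let: (q1, q2, _, l) := q in
  match q1.2, q2.2, l with
  | None, None, None | Some _, Some _, None => true
  | None, Some _, Some (inl _) | Some _, None, Some (inr _) => true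
  | _, _, _ => false
  end.

Let synced_settle (q : state) (b : bool) (m1 m2 : micro * word) :
  let: (q1, q2, dv, l) := q in
  synced q -> m1 \in moves q1 b -> m2 \in moves q2 b ->
  exists2 s, settle dv l m1.2 m2.2 = Some s & synced (m1.1, m2.1, s.1, s.2).
Proof.
move: q => [[[[v1 [h1|]] [v2 [h2|]]] dv] [[a|a]|]] //= _.
all: repeat case: (delta _ _) => [?|] //=.
all: repeat case: (obind _ _) => [?|] //=.
all: rewrite ?inE.
all: repeat (let e := fresh in case/orP => e; move: e).
all: do ?[move=> /eqP-> | move=> /orP[]] => /=; by eexists.
Qed.

Lemma settle_reachable (q : state) (b : bool) (m1 m2 : micro * word) :
  let: (q1, q2, dv, l) := q in
  reachable q -> m1 \in moves q1 b -> m2 \in moves q2 b ->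
  settle dv l m1.2 m2.2 != None.
Proof.
have inv x y : synced x -> transition x y -> synced y.
  move=> sx /existsP[c] /mapP[[y' e] + ->] /=.
  have H := synced_settle x c; move: x sx H => [[[x1 x2] dv] l] sx H.
  rewrite mem_pmap => /mapP[[[y1 e1] [y2 e2]]] /allpairsP[[n1 n2] [/= i1 i2 en]].
  case: en i1 i2 => <- <- i1 i2.
  by have [s /= -> sy [-> _]] := H _ _ sx i1 i2.
have syn x : reachable x -> synced x.
  case/connectP => p + ->; have: synced init by [].
  by elim: p init => //= y p IH x0 s0 /andP[/(inv _ _ s0) sy]; apply: IH.
have H := synced_settle q b m1 m2.
move: q (syn q) H => [[[q1 q2] dv] l] sq H r i1 i2.
by have [s -> _] := H (sq r) i1 i2.
Qed.

Definition edges (q : state) : seq (bool * (state * (word * word))) :=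
  [seq (b, t) | b <- [:: false; true], t <- succ q b].

(* A stored state with, unless it is the initial one, the index in the store of
   its predecessor, the received symbol and the two emitted words. *)
Definition node : Type := (state * option (nat * (bool * (word * word))))%type.

Inductive outcome :=
  | Success
  | Collision of word & word & word.

(* The FIFO queue is the part of the store from index [head] on. *)
Record config := Config {
  store : seq node;
  head : nat;
  result : option outcome
}.

Definition discover (i : nat) (s : seq node)
    (t : bool * (state * (word * word))) : seq node :=
  let: (b, (q, e)) := t in
  if q \in unzip1 s then s else rcons s (q, Some (i, (b, e))).

(* The received word and the two emitted words along the path to node i.
   Predecessor indices decrease, so i.+1 rounds of fuel suffice. *)
Fixpoint trace (s : seq node) (fuel i : nat) : word * word * word :=
  if fuel isn't fuel'.+1 then ([::], [::], [::]) else
  if onth s i is Some (_, Some (j, (b, (e1, e2)))) then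
    let: (z, x1, x2) := trace s fuel' j in
    (rcons z b, x1 ++ e1, x2 ++ e2)
  else ([::], [::], [::]).

Definition bfs_step (c : config) : config :=
  if result c is Some _ then c else
  if onth (store c) (head c) is Some (q, _) then
    if accepting q then
      let: (z, x1, x2) := trace (store c) (head c).+1 (head c) in
      Config (store c) (head c) (Some (Collision z x1 x2))
    else Config (foldl (discover (head c)) (store c) (edges q)) (head c).+1 None
  else Config (store c) (head c) (Some Success).

Definition bfs (k : nat) : config :=
  iter k bfs_step (Config [:: (init, None)] 0 None).

Definition bfs_returns (r : outcome) : Prop :=
  exists k, result (bfs k) = Some r.

(* The number of stored product states. *)
Definition memory (c : config) : nat := size (store c).

End Automata.

(* Main.v *)
(* A run of one parser from the root back to the root, idle at both ends, reads
   z and emits x exactly when x lies in P^* and z arises from x by disjoint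
   adjacent swaps; a permutation of displacement at most 1 is such a product of
   swaps, as one sees by looking at the preimage of the first position.  The
   product automaton runs two parsers on the same z while the lead holds the
   unmatched emitted symbol, so an accepting run is precisely a collision.  In
   the search, the predecessor indices of the store are nondecreasing, hence so
   is the depth along the store; therefore every run shorter than the depth of
   the head ends in a stored state, and the first accepting head is at minimal
   depth. *)

Require Import Defs.
From mathcomp Require Import all_boot.
From mathcomp Require Import ssrint perm zify.
From mathcomp Require Import finmap.

Set Implicit Arguments.
Unset Strict Implicit.
Unset Printing Implicit Defensive.

Local Open Scope fset_scope.

(** * Disjoint adjacent swaps and permutations of displacement at most one *)

Inductive swaps : word -> word -> Prop :=
| swaps_nil : swaps [::] [::]
| swaps_copy a x z : swaps x z -> swaps (a :: x) (a :: z)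
| swaps_swap a b x z : swaps x z -> swaps (a :: b :: x) (b :: a :: z).

Lemma swaps_size x z : swaps x z -> size x = size z.
Proof. by elim=> //= [a|a b] x' z' _ ->. Qed.

(* A permutation of the positions, extended by the identity to all of nat so
   that leading positions can be removed by shifting. *)
Definition near_perm (n : nat) (f g : nat -> nat) : Prop :=
  [/\ cancel f g, cancel g f, forall i, f i <= i.+1 /\ i <= (f i).+1
    & forall i, n <= i -> f i = i].

(** Conjugation by the shift. Since [f] and [g] both fix 0, they send successors to successors, so
    the truncated predecessor loses nothing. *)
Lemma near_perm_copy n f g :
  near_perm n.+1 f g -> f 0 = 0 ->
  near_perm n (fun i => (f i.+1).-1) (fun i => (g i.+1).-1).
Proof.
move=> [fK gK fD fid] f0; have g0 : g 0 = 0 by rewrite -{1}f0 fK.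
have fS i : (f i.+1).-1.+1 = f i.+1.
  by case E: (f i.+1) => //; move: (fK i.+1); rewrite E g0.
have gS i : (g i.+1).-1.+1 = g i.+1.
  by case E: (g i.+1) => //; move: (gK i.+1); rewrite E f0.
split=> [i|i|i|i le_ni]; first by rewrite fS fK.
- by rewrite gS gK.
- by have := fD i.+1; have := fS i; lia.
- by rewrite fid.
Qed.

Lemma near_perm_swap n f g :
  near_perm n.+2 f g -> f 0 = 1 -> f 1 = 0 ->
  near_perm n (fun i => (f i.+2).-2) (fun i => (g i.+2).-2).
Proof.
move=> [fK gK fD fid] f0 f1.
have g0 : g 0 = 1 by rewrite -{1}f1 fK.
have g1 : g 1 = 0 by rewrite -{1}f0 fK.
have fS i : (f i.+2).-2.+2 = f i.+2.
  by case E: (f i.+2) => [|[|]] //; move: (fK i.+2); rewrite E ?g0 ?g1.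
have gS i : (g i.+2).-2.+2 = g i.+2.
  by case E: (g i.+2) => [|[|]] //; move: (gK i.+2); rewrite E ?f0 ?f1.
split=> [i|i|i|i le_ni]; first by rewrite fS fK.
- by rewrite gS gK.
- by have := fD i.+2; have := fS i; lia.
- by rewrite fid.
Qed.

(** For the converse, the displacement bound leaves only 0 and 1 for [f 0]: the first block is a
    copied letter in one case and a swapped pair in the other, and the rest follows by induction on
    the length. Beyond the length both sides of the letter equation are the default [false]. *)
Lemma swaps_near_perm x z :
  swaps x z <-> size x = size z /\ exists f g, near_perm (size x) f g /\
    forall i, nth false z i = nth false x (f i).
Proof.
split=> [|[]].
  elim=> [|a x' z' _ [eq_sz [f [g [[fK gK fD fid] zE]]]]
          |a b x' z' _ [eq_sz [f [g [[fK gK fD fid] zE]]]]] /=.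
  - by split=> //; exists id, id; split.
  - split; first by rewrite eq_sz.
    exists (fun i => if i is i'.+1 then (f i').+1 else 0).
    exists (fun i => if i is i'.+1 then (g i').+1 else 0).
    split; last by case=> [|i] /=.
    split=> [[|i]|[|i]|[|i]|[|i]] //=; rewrite ?fK ?gK //.
      by have := fD i; lia.
    by move=> le_i; rewrite fid.
  - split; first by rewrite eq_sz.
    (* On the indices 0 and 1 the truncated difference [1 - i] is the transposition. *)
    exists (fun i => if i is i'.+2 then (f i').+2 else 1 - i).
    exists (fun i => if i is i'.+2 then (g i').+2 else 1 - i).
    split; last by case=> [|[|i]] /=.
    split=> [[|[|i]]|[|[|i]]|[|[|i]]|[|[|i]]] //=; rewrite ?fK ?gK //.
      by have := fD i; lia.
    by move=> le_i; rewrite fid.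
have [n] := ubnP (size x); elim: n x z => // n IH [|a x] [|c z] //=.
  by move=> *; constructor.
rewrite ltnS => lt_xn [eq_sz] [f [g [fg zE]]].
have [fK gK fD fid] := fg.
have : f 0 = 0 \/ f 0 = 1 by have := fD 0; lia.
case=> f0.
  have := zE 0; rewrite f0 /= => ->; constructor.
  apply: IH => //; exists (fun i => (f i.+1).-1), (fun i => (g i.+1).-1).
  split; first exact: near_perm_copy.
  move=> i; have := zE i.+1; case E: (f i.+1) => [|j] //=.
  by move: (fK i.+1); rewrite E -{1}f0 fK.
(* The preimage of 0 is at most 1 by the displacement bound, and it is not 0 because [f 0 = 1]. *)
have f1 : f 1 = 0.
  have := fD (g 0); rewrite gK; have := gK 0; case: (g 0) => [|[|k]]; lia.
(* A swapped pair needs two letters: in a word of length one [f] would fix 1, against [f 1 = 0]. *)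
case: x z lt_xn eq_sz fg zE fid => [|a' x] [|c' z] //= lt_xn eq_sz fg zE fid.
  by have := fid 1 isT; rewrite f1.
have := zE 0; have := zE 1; rewrite f0 f1 /= => -> ->; constructor.
case: eq_sz => eq_sz; apply: IH => //; first exact: ltnW.
exists (fun i => (f i.+2).-2), (fun i => (g i.+2).-2).
split; first exact: near_perm_swap.
move=> i; have := zE i.+2; case E: (f i.+2) => [|[|j]] //=.
  by move: (fK i.+2); rewrite E -{1}f1 fK.
by move: (fK i.+2); rewrite E -{1}f0 fK.
Qed.

Lemma ball_swaps n (c z : n.-tuple bool) : ball c z <-> swaps c z.
Proof.
rewrite swaps_near_perm !size_tuple; split=> [[pi [piD zE]]|[_]].
  split=> //.
  pose ext (s : 'S_n) i := if insub i is Some j then s j : nat else i.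
  have extO (s : 'S_n) (i : 'I_n) : ext s i = s i by rewrite /ext valK.
  have ext_id s i : n <= i -> ext s i = i.
    by move=> le_ni; rewrite /ext insubF // ltnNge le_ni.
  exists (ext pi), (ext (pi^-1)%g).
  split; last first.
    move=> i; have [le_ni|lt_in] := leqP n i.
      by rewrite ext_id // !nth_default ?size_tuple.
    by rewrite -[i]/(val (Ordinal lt_in)) extO -!tnth_nth.
  split=> [i|i|i|]; last exact: ext_id.
  - have [le_ni|lt_in] := leqP n i; first by rewrite !ext_id.
    by rewrite -[i]/(val (Ordinal lt_in)) !extO permK.
  - have [le_ni|lt_in] := leqP n i; first by rewrite !ext_id.
    by rewrite -[i]/(val (Ordinal lt_in)) !extO permKV.
  - have [le_ni|lt_in] := leqP n i; first by rewrite !ext_id.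
    by have := piD (Ordinal lt_in); have /= -> := extO pi (Ordinal lt_in); lia.
move=> [f [g [[fK gK fD fid] zE]]].
(* If [f i] were at least [n], it would be fixed by [f]; injectivity would then give [f i = i],
   which is below [n]. *)
have lt_f (i : 'I_n) : f i < n.
  rewrite ltnNge; apply/negP => le_nf.
  have := fid _ le_nf => /(can_inj fK) fi.
  by move: le_nf; rewrite fi leqNgt ltn_ord.
have inj_f : injective (fun i => Ordinal (lt_f i)).
  by move=> i j [] /(can_inj fK)/val_inj.
exists (perm inj_f); split=> i; rewrite permE /=.
  by have := fD i; lia.
by rewrite !(tnth_nth false) zE.
Qed.

(** * Incremental comparison of the two emitted words *)

(** The pending words of the new lead are exactly what the first comparison left over, so comparing
    in stages amounts to comparing the concatenations at once. *)
Lemma settle_cat dv l e1 e2 s y1 y2 :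
  settle dv l e1 e2 = Some s ->
  settle s.1 s.2 y1 y2 = settle dv l (e1 ++ y1) (e2 ++ y2).
Proof.
have compare_cat d u1 u2 w1 w2 :
    compare d (u1 ++ w1) (u2 ++ w2) =
    let: (d', (r1, r2)) := compare d u1 u2 in compare d' (r1 ++ w1) (r2 ++ w2).
  by elim: u1 u2 d => [|a u1 IH] [|b u2] d //=.
rewrite /settle !catA (compare_cat dv (_ ++ e1) (_ ++ e2)) /=.
case: (compare dv _ _) => d [r1 r2].
by case: r1 r2 => [|a [|? ?]] [|b [|? ?]] //=; case=> <-.
Qed.

Lemma settle_init x1 x2 :
  size x1 = size x2 -> settle false None x1 x2 = Some (x1 != x2, None).
Proof.
rewrite /settle /= => eq_sz.
suff -> d : compare d x1 x2 = (d || (x1 != x2), ([::], [::])) by [].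
elim: x1 x2 d eq_sz => [|a x1 IH] [|b x2] d //=; first by rewrite orbF.
by case=> /IH ->; rewrite eqseq_cons negb_and orbA.
Qed.

(** * Walks in the trie and membership in $P^*$ *)

Section Product.

Variable P : {fset word}.

Fixpoint walk (v : trie P) (x : word) : option (trie P) :=
  if x is b :: x' then obind (walk^~ x') (delta v b) else Some v.

Lemma walk_cat v x y : walk v (x ++ y) = obind (walk^~ y) (walk v x).
Proof. by elim: x v => //= b x IH v; case: (delta v b) => /=. Qed.

Lemma star_cat w x : w \in P -> star P x -> star P (w ++ x).
Proof.
move=> wP [s [sP ->]]; exists (w :: s); split=> // u.
by rewrite inE => /predU1P[->|/sP].
Qed.

(** Stated for an arbitrary vertex so that the induction goes through: [val v] is the part of the
    current word of [P] that has already been read. *)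
Lemma walk_star v x : walk v x = Some (Defs.root P) -> star P (val v ++ x).
Proof.
elim: x v => [|b x IH] v /=; first by case=> ->; exists [::].
rewrite /delta; case: insubP => [v' _ def_v'|_] /=.
  by move/IH; rewrite def_v' cat_rcons.
case: ifP => //= vbP /IH st.
by rewrite -cat_rcons; apply: star_cat.
Qed.

Hypotheses (P0 : [::] \notin P) (pfP : prefix_free P).

Lemma walk_word w : w \in P -> walk (Defs.root P) w = Some (Defs.root P).
Proof.
move=> wP.
suff walkP r (v : trie P) :
    r != [::] -> val v ++ r = w -> walk v r = Some (Defs.root P).
  by apply: (walkP w (Defs.root P)) => //; apply: contraNneq P0 => <-.
elim: r v => // b r IH v _; rewrite -cat_rcons /= /delta.
case: r IH => [_|c r IH] def_w.
  (* At the last letter the whole word [w] has been read. It is nonempty and, by prefix-freeness, no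
     proper prefix of a word of [P], so it is not a vertex and [delta] returns to the root. *)
  rewrite cats0 in def_w; rewrite insubF def_w ?wP //; apply/negbTE/trieP.
  case=> [w0|[u uP wu]]; first by rewrite -w0 wP in (P0).
  by have := pfP wP uP; rewrite wu.
have vb_in : rcons (val v) b \in trie P.
  apply/trieP; right; exists w => //; rewrite /proper_prefix -def_w.
  rewrite prefix_prefix /=; apply/eqP => /(congr1 size).
  by rewrite size_cat /=; lia.
by rewrite insubT /=; apply: IH.
Qed.

Lemma star_walk x : star P x <-> walk (Defs.root P) x = Some (Defs.root P).
Proof.
split=> [[s [sP ->]]|/walk_star //].
elim: s sP => //= w s IH sP.
rewrite walk_cat walk_word ?sP ?mem_head //=; apply: IH => u us.
by rewrite sP ?inE ?us ?orbT.
Qed.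

(** * Runs of a single parser *)

Fixpoint parse (m : micro P) (z x : word) (m' : micro P) : Prop :=
  if z is b :: z' then
    exists2 t, t \in moves m b & exists2 y, x = t.2 ++ y & parse t.1 z' y m'
  else x = [::] /\ m' = m.

(** Between idle states a run splits into copies and pairs of a swap-start with its swap-resolve,
    which are the two recursive constructors of [swaps]. The vertex follows the emitted word, not
    the received one. *)
Lemma parse_idle v z x v' :
  parse (v, None) z x (v', None) <-> swaps x z /\ walk v x = Some v'.
Proof.
split=> [|[]].
  (* Strong induction on the length, since a swap consumes two received symbols. *)
  have [n] := ubnP (size z); elim: n z v x => // n IH [|b z] v x /=.
    by move=> _ [-> [<-]]; split=> //; constructor.
  rewrite ltnS => lt_zn [t]; rewrite mem_cat => /orP[].
    case def_v1: (delta v b) => [v1|] //; rewrite inE => /eqP-> /= [y ->].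
    case/IH=> // sw wk; rewrite /= def_v1 /=; split=> //.
    by constructor.
  rewrite inE => /eqP-> /= [{}x ->].
  (* Input ending right after a swap-start would leave the parser holding a symbol, but the final
     mode is idle. *)
  case: z lt_zn => [|c z] lt_zn; first by case.
  case=> t1 /=; case def_v1: (delta v c) => [v1|] //=.
  case def_v2: (delta v1 b) => [v2|] //=; rewrite inE => /eqP-> /= [y ->].
  case/IH=> [|sw wk]; first exact: ltn_trans lt_zn.
  rewrite /= def_v1 /= def_v2 /=; split=> //.
  by constructor.
move=> sw; elim: sw v => {x z} [|a x z sw IH|a b x z sw IH] v /=.
- by case=> ->.
- case def_v1: (delta v a) => [v1|] //= /IH pz.
  exists ((v1, None), [:: a]); first by rewrite mem_head.
  by exists x.
- case def_v1: (delta v a) => [v1|] //=.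
  case def_v2: (delta v1 b) => [v2|] //= /IH pz.
  exists ((v, Some b), [::]); first by rewrite mem_cat mem_head orbT.
  exists [:: a, b & x] => //=; rewrite def_v1 /= def_v2.
  by exists ((v2, None), [:: a; b]); rewrite ?mem_head //; exists x.
Qed.

(** * Runs of the product automaton and collisions *)

Fixpoint run (q : state P) (z x1 x2 : word) (q' : state P) : Prop :=
  if z is b :: z' then
    exists2 t, t \in succ q b & exists y1 y2,
      [/\ x1 = t.2.1 ++ y1, x2 = t.2.2 ++ y2 & run t.1 z' y1 y2 q']
  else [/\ x1 = [::], x2 = [::] & q' = q].

Lemma run_rcons q z x1 x2 q1 b t :
  run q z x1 x2 q1 -> t \in succ q1 b ->
  run q (rcons z b) (x1 ++ t.2.1) (x2 ++ t.2.2) t.1.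
Proof.
move=> + t_in; elim: z q x1 x2 => [|c z IH] q x1 x2 /=.
  by case=> -> -> <-; exists t => //; exists [::], [::]; rewrite !cats0.
case=> u u_in [y1 [y2 [-> -> r]]]; exists u => //.
exists (y1 ++ t.2.1), (y2 ++ t.2.2).
by rewrite !catA; split=> //; apply: IH.
Qed.

Lemma run_rcons_inv q z b x1 x2 q' :
  run q (rcons z b) x1 x2 q' ->
  exists q1 y1 y2 t, [/\ run q z y1 y2 q1, t \in succ q1 b & q' = t.1].
Proof.
elim: z q x1 x2 => [|c z IH] q x1 x2 /=.
  case=> t t_in [y1 [y2 [_ _ [_ _ ->]]]].
  by exists q, [::], [::], t.
case=> u u_in [y1 [y2 [_ _ /IH[q1 [w1 [w2 [t [r t_in ->]]]]]]]].
exists q1, (u.2.1 ++ w1), (u.2.2 ++ w2), t; split=> //.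
by exists u => //; exists w1, w2.
Qed.

Lemma succP q1 q2 dv l b (t : state P * (word * word)) :
  t \in succ (q1, q2, dv, l) b <->
  exists m1 m2 s, [/\ m1 \in moves q1 b, m2 \in moves q2 b,
    settle dv l m1.2 m2.2 = Some s &
    t = ((m1.1, m2.1, s.1, s.2), (m1.2, m2.2))].
Proof.
rewrite /succ mem_pmap; split.
  case/mapP=> -[[n1 e1] [n2 e2]] /allpairsP[[m1 m2] [/= i1 i2 [E1 E2]]].
  rewrite -{}E1 in i1; rewrite -{}E2 in i2.
  case def_s: (settle _ _ _ _) => [s|] //= [->].
  by exists (n1, e1), (n2, e2), s.
case=> [[n1 e1] [[n2 e2] [s [i1 i2 def_s ->]]]].
apply/mapP; exists ((n1, e1), (n2, e2)); last by rewrite /= def_s.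
by apply/allpairsP; exists ((n1, e1), (n2, e2)).
Qed.

Lemma reachable_succ (q : state P) b t :
  reachable q -> t \in succ q b -> reachable t.1.
Proof.
move=> rq tb; apply: connect_trans rq (connect1 _).
by apply/existsP; exists b; apply: map_f.
Qed.

Lemma run_reachable q z x1 x2 q' :
  reachable q -> run q z x1 x2 q' -> reachable q'.
Proof.
elim: z q x1 x2 => [|b z IH] q x1 x2 rq /=; first by case=> _ _ ->.
case=> t t_in [y1 [y2 [_ _ r]]].
exact: IH (reachable_succ rq t_in) r.
Qed.

Lemma reachable_run q : reachable q -> exists z x1 x2, run (init P) z x1 x2 q.
Proof.
case/connectP=> p + ->.
elim/last_ind: p => [|p q' IH] /=; first by exists [::], [::], [::].
rewrite rcons_path last_rcons => /andP[/IH[z [x1 [x2 r]]]].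
case/existsP=> b /mapP[t t_in ->].
by do 3 eexists; apply: run_rcons r t_in.
Qed.

(** The parsers interact only through the comparison, and by [settle_cat] its stages merge into one
    comparison of the full emitted words. *)
Lemma run_parse q1 q2 dv l z x1 x2 q1' q2' dv' l' :
  reachable (q1, q2, dv, l) ->
  run (q1, q2, dv, l) z x1 x2 (q1', q2', dv', l') <->
  [/\ parse q1 z x1 q1', parse q2 z x2 q2'
    & settle dv l x1 x2 = Some (dv', l')].
Proof.
elim: z q1 q2 dv l x1 x2 => [|b z IH] q1 q2 dv l x1 x2 rq /=.
  have settle0 : settle dv l [::] [::] = Some (dv, l) by case: l {rq} => [[]|].
  split; first by case=> -> -> [-> -> -> ->]; rewrite settle0.
  by case=> [[-> ->] [-> ->]]; rewrite settle0 => -[-> ->].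
split.
  case=> t t_in [y1 [y2 [-> ->]]]; have rt := reachable_succ rq t_in.
  have /succP[m1 [m2 [s [i1 i2 def_s def_t]]]] := t_in.
  rewrite def_t /= in rt *.
  case/(IH _ _ _ _ _ _ rt) => p1 p2; rewrite (settle_cat _ _ def_s) => st.
  by split=> //; [exists m1 => //; exists y1 | exists m2 => //; exists y2].
case=> -[m1 i1 [y1 -> p1]] [m2 i2 [y2 -> p2]] st.
(* Reachability guarantees that the lead never overflows, so any pair of legal parser moves is a
   product transition. *)
have := @settle_reachable P (q1, q2, dv, l) b m1 m2 rq i1 i2.
case def_s: (settle _ _ _ _) => [s|] // _.
pose t : state P * (word * word) := ((m1.1, m2.1, s.1, s.2), (m1.2, m2.2)).
have t_in : t \in succ (q1, q2, dv, l) b by apply/succP; exists m1, m2, s.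
exists t => //; exists y1, y2; split=> //; apply/IH.
  exact: reachable_succ rq t_in.
by rewrite (settle_cat _ _ def_s).
Qed.

(** Swaps preserve length, so both emitted words are as long as [z]: the comparison uses them up,
    and the final flag says whether they differ. *)
Lemma accepting_run z x1 x2 :
  run (init P) z x1 x2
    ((Defs.root P, None), (Defs.root P, None), true, None) <->
  [/\ star P x1, star P x2, x1 <> x2, swaps x1 z & swaps x2 z].
Proof.
rewrite run_parse; last exact: connect0.
split.
  case=> /parse_idle[sw1 wk1] /parse_idle[sw2 wk2].
  rewrite settle_init ?(swaps_size sw1) ?(swaps_size sw2) // => -[/eqP ne].
  by split=> //; apply/star_walk.
case=> /star_walk st1 /star_walk st2 /eqP ne sw1 sw2.
by rewrite settle_init ?ne ?(swaps_size sw1) ?(swaps_size sw2) //;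
  split=> //; apply/parse_idle.
Qed.

Lemma collision_run n (z c1 c2 : n.-tuple bool) :
  collision P z c1 c2 <->
  run (init P) z c1 c2 ((Defs.root P, None), (Defs.root P, None), true, None).
Proof.
rewrite accepting_run; split=> -[st1 st2 ne].
  move=> /ball_swaps sw1 /ball_swaps sw2; split=> // /val_inj; exact: ne.
by move=> /ball_swaps sw1 /ball_swaps sw2; split=> // e; apply: ne; rewrite e.
Qed.

End Product.

(** * Invariants of the breadth-first search *)

Section Search.

Variable P : {fset word}.

Notation node0 := ((init P, None) : node P).
Notation node_at s i := (nth node0 s i).

(** The initial node gets parent index 0, the least value, so that parents can be nondecreasing
    along the whole store. *)
Definition parent (x : node P) : nat := if x.2 is Some (j, _) then j else 0.

(** [wf_mono] expresses the first-in first-out discipline. [wf_head] preserves it: every new node is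
    appended with parent [h]. *)
Record store_wf (s : seq (node P)) (h : nat) : Prop := StoreWf {
  wf_root : 0 < size s /\ node_at s 0 = node0;
  wf_uniq : uniq (unzip1 s);
  wf_edge : forall i, 0 < i < size s -> exists j b e,
    [/\ (node_at s i).2 = Some (j, (b, e)), j < i &
        ((node_at s i).1, e) \in succ (node_at s j).1 b];
  wf_mono : forall i i', i <= i' < size s ->
    parent (node_at s i) <= parent (node_at s i');
  wf_head : forall i, i < size s -> parent (node_at s i) <= h
}.

(** The bound on the parent is what later limits the depth of [q] to one more than that of node
    [i]. *)
Definition covered (s : seq (node P)) (i : nat) (q : state P) : Prop :=
  exists i',
    [/\ i' < size s, (node_at s i').1 = q & parent (node_at s i') <= i].

Lemma covered_cat s r i q : covered s i q -> covered (s ++ r) i q.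
Proof.
case=> i' [lt_i' def_q le_p]; exists i'.
by rewrite nth_cat lt_i' size_cat ltn_addr.
Qed.

Lemma mem_store s q :
  reflect (exists2 i, i < size s & (node_at s i).1 = q) (q \in unzip1 s).
Proof.
apply: (iffP (nthP (init P))); rewrite size_map.
  by case=> i lt_i <-; exists i => //; rewrite (nth_map node0).
by case=> i lt_i <-; exists i => //; rewrite (nth_map node0).
Qed.

Lemma edgesP (q : state P) b t : (b, t) \in edges q <-> t \in succ q b.
Proof.
split=> [/allpairsPdep[c [u [_ + [-> ->]]]] //|t_in].
by apply/allpairsPdep; exists b, t; split=> //; case: b {t_in}.
Qed.

(** The target is covered in either case: an old node has its parent bounded by [wf_head], a new one
    has parent [h]. *)
Lemma discover_wf s h t :
  store_wf s h -> h < size s -> t \in edges (node_at s h).1 ->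
  exists r, [/\ discover h s t = s ++ r, store_wf (s ++ r) h &
                covered (s ++ r) h t.2.1].
Proof.
case: t => b [q e] wf lt_h t_in /=; have [s_gt0 s0] := wf_root wf.
case: ifPn => [/mem_store[i lt_i def_q]|new_q].
  exists [::]; rewrite cats0; split=> //; exists i; split=> //.
  exact: wf_head wf _ lt_i.
exists [:: (q, Some (h, (b, e)))]; rewrite cats1; set x := (q, _).
have nthO i : i < size s -> node_at (rcons s x) i = node_at s i.
  by move=> lt_i; rewrite nth_rcons lt_i.
have nthS : node_at (rcons s x) (size s) = x by rewrite nth_rcons ltnn eqxx.
have headx i : i <= size s -> parent (node_at (rcons s x) i) <= h.
  rewrite leq_eqVlt => /predU1P[->|lt_i]; first by rewrite nthS.
  by rewrite nthO //; apply: wf_head wf _ lt_i.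
split=> //; last by exists (size s); rewrite size_rcons nthS.
split; rewrite ?size_rcons //=.
- by rewrite nthO.
- by rewrite /unzip1 map_rcons rcons_uniq new_q; apply: wf_uniq wf.
- move=> i /andP[i_gt0]; rewrite ltnS leq_eqVlt => /predU1P[->|lt_i].
    by exists h, b, e; rewrite nthS nthO //; split=> //; apply/edgesP.
  have [|j [b' [e' [E lt_j in_j]]]] := wf_edge wf (i := i); first exact/andP.
  by exists j, b', e'; rewrite !nthO // (ltn_trans lt_j).
- move=> i i' /andP[le_i]; rewrite ltnS leq_eqVlt => /predU1P[E|lt_i'].
    by rewrite E nthS; apply: headx; rewrite -E.
  rewrite !nthO ?(leq_ltn_trans le_i) //.
  by apply: wf_mono wf _ _ _; rewrite le_i.
Qed.

Lemma discover_all_wf s h ts :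
  store_wf s h -> h < size s -> {subset ts <= edges (node_at s h).1} ->
  exists r, [/\ foldl (discover h) s ts = s ++ r, store_wf (s ++ r) h &
                forall t, t \in ts -> covered (s ++ r) h t.2.1].
Proof.
elim: ts s => [|t ts IH] s wf lt_h sub /=.
  by exists [::]; rewrite cats0.
have [|r1 [-> wf1 cov1]] := discover_wf wf lt_h (t := t).
  by apply: sub; rewrite mem_head.
have [|u u_in|r2 [-> wf2 cov2]] := IH _ wf1.
- by rewrite size_cat ltn_addr.
- by rewrite nth_cat lt_h; apply: sub; rewrite inE u_in orbT.
exists (r1 ++ r2); rewrite catA; split=> // u; rewrite inE.
by case/predU1P=> [->|/cov2 //]; apply: covered_cat.
Qed.

Definition explored (s : seq (node P)) (h : nat) : Prop :=
  forall i b t, i < h -> t \in succ (node_at s i).1 b -> covered s i t.1.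

Definition returned (c : config P) (o : outcome) : Prop :=
  match o with
  | Success => Defs.head c = size (store c)
  | Collision z x1 x2 =>
      [/\ Defs.head c < size (store c),
          accepting (node_at (store c) (Defs.head c)).1
        & trace (store c) (Defs.head c).+1 (Defs.head c) = (z, x1, x2)]
  end.

(** As long as there is no result, each step advances the head by one; the equation with [k] in
    [inv_result] yields termination. *)
Record bfs_inv (k : nat) (c : config P) : Prop := BfsInv {
  inv_wf : store_wf (store c) (Defs.head c);
  inv_explored : explored (store c) (Defs.head c);
  inv_head : Defs.head c <= size (store c);
  inv_rejected : forall i, i < Defs.head c ->
    ~~ accepting (node_at (store c) i).1;
  inv_result : if result c is Some o then returned c o else Defs.head c = k
}.

Lemma onth_node s i :
  onth s i = if i < size s then Some (node_at s i) else None.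
Proof. by elim: s i => [|x s IH] [|i] //=; rewrite IH. Qed.

Lemma bfsP k : bfs_inv k (bfs P k).
Proof.
elim: k => [|k]; last rewrite /bfs iterS -/(bfs P k).
  split=> //=; split=> //= [[|i]|i [|i']|[|i]] //; last by rewrite andbF.
  by case: i.
case: (bfs P k) => s h [o|] [/= wf ex le_h rej res].
  by rewrite /bfs_step; split.
rewrite /bfs_step; cbn [result store Defs.head]; rewrite onth_node.
case: ifPn => [lt_h|]; last first.
  by rewrite -leqNgt => ge_h; split=> //=; apply/eqP; rewrite eqn_leq le_h.
case def_n: (node_at s h) => [q o].
case: ifPn => [acc|nacc].
  case def_t: (trace s h.+1 h) => [[z x1] x2]; split=> //.
  by split=> //; rewrite /= def_n.
have [|r [-> wf' cov]] := discover_all_wf wf lt_h (ts := edges q).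
  by rewrite def_n.
split=> /=.
- case: wf' => rt un ed mo hd; split=> // i lt_i.
  exact: leq_trans (hd _ lt_i) _.
- move=> i b t; rewrite ltnS leq_eqVlt => /predU1P[->|lt_i].
    rewrite nth_cat lt_h def_n => t_in.
    by apply: (cov (b, t)); apply/edgesP.
  rewrite nth_cat (leq_trans lt_i le_h) => t_in.
  by apply: covered_cat; apply: ex t_in.
- by rewrite size_cat ltn_addr.
- move=> i; rewrite ltnS leq_eqVlt => /predU1P[->|lt_i].
    by rewrite nth_cat lt_h def_n.
  by rewrite nth_cat (leq_trans lt_i le_h); apply: rej.
- by rewrite res.
Qed.

(** * Reconstructed paths and their lengths *)

Section Depth.

Variables (s : seq (node P)) (h : nat).
Hypothesis wf : store_wf s h.

Lemma trace_run f i : i < size s -> i < f ->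
  run (init P) (trace s f i).1.1 (trace s f i).1.2 (trace s f i).2
      (node_at s i).1.
Proof.
have [s_gt0 s0] := wf_root wf.
elim: f i => // f IH i lt_i lt_if /=; rewrite onth_node lt_i.
case: (posnP i) => [->|i_gt0]; first by rewrite s0.
have [|j [b [[e1 e2] [E lt_j in_j]]]] := wf_edge wf (i := i).
  by rewrite i_gt0.
case def_n: (node_at s i) E in_j => [q o] /= -> in_j.
have := IH j (ltn_trans lt_j lt_i) (leq_trans lt_j lt_if).
case: (trace s f j) => [[z x1] x2] /= r.
exact: run_rcons r in_j.
Qed.

(** Tracing node [i] leaves its predecessor [j] with fuel [i], whereas [depth j] uses [j.+1]; this
    identifies the two. *)
Lemma trace_fuel f f' i : i < size s -> i < f -> i < f' ->
  trace s f i = trace s f' i.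
Proof.
have [s_gt0 s0] := wf_root wf.
elim: f f' i => // f IH [|f'] i // lt_i lt_if lt_if' /=; rewrite onth_node lt_i.
case: (posnP i) => [->|i_gt0]; first by rewrite s0.
have [|j [b [[e1 e2] [E lt_j in_j]]]] := wf_edge wf (i := i).
  by rewrite i_gt0.
case: (node_at s i) E => [q o] /= ->.
by rewrite (IH f') ?(ltn_trans lt_j lt_i) ?(leq_trans lt_j).
Qed.

Definition depth (i : nat) : nat := size (trace s i.+1 i).1.1.

Lemma depth0 : depth 0 = 0.
Proof.
have [s_gt0 s0] := wf_root wf.
by rewrite /depth /=; case: (s) s_gt0 s0 => [|x r] //= _ ->.
Qed.

Lemma depth_parent i : 0 < i < size s ->
  parent (node_at s i) < i /\ depth i = (depth (parent (node_at s i))).+1.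
Proof.
move=> i_bd; have [j [b [[e1 e2] [E lt_j in_j]]]] := wf_edge wf i_bd.
have /andP[_ lt_i] := i_bd.
rewrite {1}/depth [trace s i.+1 i]/= onth_node lt_i /parent.
case: (node_at s i) E => [q o] /= ->; split=> //.
rewrite /depth (trace_fuel (f' := j.+1)) ?(ltn_trans lt_j lt_i) //.
by case: (trace s j.+1 j) => [[z x1] x2] /=; rewrite size_rcons.
Qed.

(** Each noninitial node lies one deeper than its parent, and parents have smaller indices in the
    same order, so induction on the larger index applies. *)
Lemma depth_mono i i' : i <= i' < size s -> depth i <= depth i'.
Proof.
have [n] := ubnP i'; elim: n i i' => // n IH i i'.
rewrite ltnS => lt_n /andP[le_i lt_i'].
case: (posnP i) => [->|i_gt0]; first by rewrite depth0.
have [|lt_p ->] := depth_parent (i := i).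
  by rewrite i_gt0 (leq_ltn_trans le_i).
have [|lt_p' ->] := depth_parent (i := i').
  by rewrite (leq_trans i_gt0).
rewrite ltnS; apply: IH; first exact: leq_trans lt_p' lt_n.
by rewrite (wf_mono wf) ?le_i // (ltn_trans lt_p').
Qed.

(* While the head is at depth greater than the length of a run, every state on
   the run has been stored no deeper than its position there. *)
Lemma depth_run z x1 x2 q :
  explored s h -> h < size s -> run (init P) z x1 x2 q ->
  depth h <= size z \/
  exists i, [/\ i < size s, (node_at s i).1 = q & depth i <= size z].
Proof.
move=> ex lt_h; have [s_gt0 s0] := wf_root wf.
elim/last_ind: z x1 x2 q => [|z b IH] x1 x2 q.
  by case=> _ _ ->; right; exists 0; rewrite s0 depth0.
case/run_rcons_inv=> q1 [y1 [y2 [t [/IH le_q1 t_in ->]]]].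
rewrite size_rcons; case: le_q1 => [le_h|[i [lt_i def_q1 le_i]]].
  by left; apply: leqW.
have [le_h|lt_ih] := leqP (depth h) (size z); first by left; apply: leqW.
(* A node at or behind the head would be at least as deep as the head, hence deeper than [size z].
   So node [i] has been expanded. *)
have lt_hi : i < h.
  rewrite ltnNge; apply/negP => le_hi.
  by have := @depth_mono h i; rewrite le_hi lt_i => /(_ isT); lia.
rewrite -def_q1 in t_in; have [i' [lt_i' def_t le_p]] := ex _ _ _ lt_hi t_in.
right; exists i'; split=> //.
case: (posnP i') => [->|i'_gt0]; first by rewrite depth0.
have [|lt_p ->] := depth_parent (i := i'); first by rewrite i'_gt0.
rewrite ltnS; apply: leq_trans le_i; apply: depth_mono.
by rewrite le_p.
Qed.

End Depth.

(** * Memory, termination and correctness of the outcome *)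

Lemma store_size s h : store_wf s h -> size s <= #|state P|.
Proof.
move/wf_uniq=> un; rewrite -(size_map fst).
by rewrite -(card_uniqP un); apply: max_card.
Qed.

(** Each parser has $3|V|$ micro-states, the flag 2 values and the lead 5, and
    $3\cdot3\cdot2\cdot5=90$. *)
Lemma card_state : #|state P| = 90 * #|` trie P| ^ 2.
Proof.
rewrite !card_prod !card_option !card_sum card_bool -cardfE.
by lia.
Qed.

(** A search still running after one step more than there are states would have its head beyond the
    largest possible store. *)
Lemma bfs_returns_ex : exists o, bfs_returns P o.
Proof.
have [wf _ le_h _] := bfsP #|state P|.+1.
case def_o: (result _) => [o|] h_eq; first by exists o, #|state P|.+1.
by have := leq_trans le_h (store_size wf); rewrite h_eq ltnn.
Qed.

Lemma bfs_returns_inj o o' : bfs_returns P o -> bfs_returns P o' -> o = o'.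
Proof.
have stable k d : forall p, result (bfs P k) = Some p ->
    result (bfs P (d + k)) = Some p.
  move=> p def_p; elim: d => // d IH; rewrite addSn /bfs iterS -/(bfs P _).
  by rewrite /bfs_step IH.
move=> [k def_o] [k' def_o'].
have := stable _ k' _ def_o; rewrite addnC (stable _ k _ def_o').
by case.
Qed.

(** On success the head has passed the whole store, so the store is closed under transitions and
    contains the end of every run from [init]; all its states were rejected. *)
Lemma success_unreachable :
  bfs_returns P Success -> forall q : state P, reachable q -> ~~ accepting q.
Proof.
case=> k def_o; have [wf ex _ rej] := bfsP k; rewrite def_o /= => h_eq.
move=> q /reachable_run[z [x1 [x2]]].
suff: run (init P) z x1 x2 q ->
    exists2 i, i < size (store (bfs P k)) & (node_at (store (bfs P k)) i).1 = q.
  by move=> H /H[i lt_i <-]; apply: rej; rewrite h_eq.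
elim/last_ind: z x1 x2 q => [|z b IH] x1 x2 q.
  by case=> _ _ ->; have [s_gt0 s0] := wf_root wf; exists 0; rewrite ?s0.
case/run_rcons_inv=> q1 [y1 [y2 [t [/IH[i lt_i <-] t_in ->]]]].
rewrite -h_eq in lt_i; have [i' [lt_i' def_t _]] := ex _ _ _ lt_i t_in.
by exists i'.
Qed.

Lemma collision_returned z x1 x2 : bfs_returns P (Collision z x1 x2) ->
  let acc := ((Defs.root P, None), (Defs.root P, None), true, None) in
  run (init P) z x1 x2 acc /\
  forall z' y1 y2, run (init P) z' y1 y2 acc -> size z <= size z'.
Proof.
case=> k def_o; have [wf ex _ rej] := bfsP k.
rewrite def_o => -[lt_h /eqP acc def_t].
have := trace_run wf lt_h (ltnSn _); rewrite def_t acc; split=> // z' y1 y2 r.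
have -> : size z = depth (store (bfs P k)) (Defs.head (bfs P k)).
  by rewrite /depth def_t.
(* Either the competing run is already long enough, or its accepting state is stored no deeper than
   its length; states are stored once, so that node is the head itself. *)
have [//|[i [lt_i def_i le_i]]] := depth_run wf ex lt_h r.
suff <- : i = Defs.head (bfs P k) by [].
apply/eqP; rewrite -(nth_uniq (init P) _ _ (wf_uniq wf)) ?size_map //.
by rewrite !(nth_map node0) // acc def_i.
Qed.

End Search.

Theorem theorem14 :
  exists K : nat, forall P : {fset word},
    [::] \notin P -> prefix_free P ->
    [/\ #|state P| <= 90 * #|` trie P| ^ 2,
        (exists r, bfs_returns P r) /\
          (forall k, memory (bfs P k) <= K * #|` trie P| ^ 2),
        bfs_returns P Success <-> (forall q : state P, reachable q -> ~~ accepting q),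
        bfs_returns P Success <-> (forall n, correcting (@code P n))
      & ~ bfs_returns P Success ->
          exists n (z c1 c2 : n.-tuple bool),
            bfs_returns P (Collision z c1 c2) /\ shortest_collision P z c1 c2].
Proof.
exists 90 => P P0 pfP.
have found : ~ bfs_returns P Success ->
    exists n (z c1 c2 : n.-tuple bool),
      bfs_returns P (Collision z c1 c2) /\ shortest_collision P z c1 c2.
  move=> nsucc; have [[|z x1 x2] ret] := bfs_returns_ex P; first by case: nsucc.
  have [r min] := collision_returned ret.
  have [_ _ _ sw1 sw2] := (accepting_run P0 pfP z x1 x2).1 r.
  have sz1 : size x1 == size z by rewrite (swaps_size sw1).
  have sz2 : size x2 == size z by rewrite (swaps_size sw2).
  exists (size z), (in_tuple z), (Tuple sz1), (Tuple sz2); split=> //.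
  split=> [|m z' c1 c2 /(collision_run P0 pfP) /min];
    last by rewrite size_tuple.
  exact/(collision_run P0 pfP).
(* This dichotomy is constructive: the search returns some outcome, and only one. *)
have decided : bfs_returns P Success \/ ~ bfs_returns P Success.
  have [[|z x1 x2] ret] := bfs_returns_ex P; [by left | right].
  by move/(bfs_returns_inj ret).
have no_collision n (z c1 c2 : n.-tuple bool) :
    bfs_returns P Success -> ~ collision P z c1 c2.
  move=> /success_unreachable nacc /(collision_run P0 pfP) r.
  have := nacc _ (run_reachable (connect0 _ _) r).
  by rewrite /accepting eqxx.
split=> //.
- by rewrite card_state.
- split=> [|k]; first exact: bfs_returns_ex.
  by rewrite -card_state; apply: store_size (inv_wf (bfsP P k)).
- split=> [|nacc]; first exact: success_unreachable.
  case: decided => // /found[n [z [c1 [c2 [_ [/(collision_run P0 pfP) r _]]]]]].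
  have := nacc _ (run_reachable (connect0 _ _) r).
  by rewrite /accepting eqxx.
- split=> [succ n c1 c2 C1 C2 ne [z [b1 b2]]|corr].
    exact: (no_collision n z c1 c2 succ).
  case: decided => // /found[n [z [c1 [c2 [_ [[C1 C2 ne b1 b2] _]]]]]].
  by case: (corr n c1 c2 C1 C2 ne); exists z.
Qed.
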